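(* Let $I \subset S = K[x_1,\dots,x_n]$ be a monomial ideal with irredundant irreducible decomposition $I = \bigcap_{i=1}^r Q_i$, and let $P = \langle x_{i_1}, \dots, x_{i_k} \rangle \in \mathrm{Ass}(I)$ (with $i_1,\dots,i_k$ distinct). Let $Q = \langle x_{i_1}^{a_1},\dots,x_{i_k}^{a_k} \rangle$ be a $P$-primary component of $I$ in the irredundant irreducible decomposition of $I$ (that is, $Q$ is one of the $Q_i$ and $\sqrt{Q}=P$). Let $\{s_1, \ldots, s_{n-k}\}= [n] \setminus \{i_1, \dots , i_k\}$. Then for any choice of integers $b_j \geq \max\{\nu_{s_j}(u) \mid u \in G(I)\}$, $j \in [n-k]$, the monomial $$v= x_{i_1}^{a_1 - 1} x_{i_2}^{a_2 - 1} \cdots x_{i_k}^{a_k - 1} x_{s_1}^{b_1} \cdots x_{s_{n-k}}^{b_{n-k}}$$ satisfies $P = (I : v)$.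
   Context: $K$ is a field, $S = K[x_1,\dots,x_n]$, and $[m]=\{1,\dots,m\}$. A monomial ideal is an ideal generated by monomials; $G(I)$ denotes its unique minimal set of monomial generators. For a monomial $u$, $\nu_i(u)$ is the exponent of $x_i$ in $u$ (equal to $0$ if $x_i$ does not divide $u$). $\mathrm{Ass}(I)$ is the set of associated primes of $S/I$; for a monomial ideal each is generated by a subset of the variables. The irredundant irreducible decomposition of a monomial ideal $I$ is the unique presentation $I=\bigcap_{i=1}^r Q_i$ in which each $Q_i$ is generated by pure powers of variables (i.e. $Q_i=\langle x_{j_1}^{c_1},\dots,x_{j_m}^{c_m}\rangle$ with distinct $j_1,\dots,j_m$ and all $c_l\ge 1$) and none of the $Q_i$ can be omitted. Such an ideal $\langle x_{j_1}^{c_1},\dots,x_{j_m}^{c_m}\rangle$ is $\langle x_{j_1},\dots,x_{j_m}\rangle$-primary. The colon ideal is $(I:v)=\{f\in S : fv\in I\}$. *)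

(* Defs.v *)
From mathcomp Require Export all_boot all_order all_algebra.
From mathcomp Require Export boolp classical_sets.
From mathcomp Require Export mpoly.

Set Implicit Arguments.
Unset Strict Implicit.
Unset Printing Implicit Defensive.

Import GRing.Theory.

Local Open Scope classical_set_scope.
Local Open Scope ring_scope.

(* Ideals are Prop-valued sets.  The structures of ring_quotient are not used
   because they only cover proper ideals with a boolean membership test. *)

Definition is_ideal (R : comNzRingType) (I : set R) : Prop :=
  [/\ I 0, (forall f g, I f -> I g -> I (f + g))
    & (forall h f, I f -> I (h * f))].

Definition is_prime_ideal (R : comNzRingType) (P : set R) : Prop :=
  [/\ is_ideal P, ~ P 1 & forall f g, P (f * g) -> P f \/ P g].

Definition ideal_span (R : comNzRingType) (A : set R) : set R :=
  smallest (@is_ideal R) A.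

Definition colon (R : comNzRingType) (I : set R) (v : R) : set R :=
  [set f | I (f * v)].

Definition radical (R : comNzRingType) (I : set R) : set R :=
  [set f | exists m : nat, I (f ^+ m)].

(* The annihilator of the class of f in the module R / I is colon I f. *)
Definition Ass (R : comNzRingType) (I : set R) : set (set R) :=
  [set P | is_prime_ideal P /\ exists f : R, P = colon I f].

(* The ideal generated by the monomials whose exponent vectors lie in A. *)
Definition monomial_span (K : fieldType) (n : nat) (A : set 'X_{1..n}) :
    set {mpoly K[n]} :=
  ideal_span [set 'X_[m] | m in A].

Definition is_monomial_ideal (K : fieldType) (n : nat)
    (I : set {mpoly K[n]}) : Prop :=
  exists A : set 'X_{1..n}, I = monomial_span A.

(* G is the set G(I), each monomial being given by its exponent vector. *)
Definition is_minimal_monomial_generators (K : fieldType) (n : nat)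
    (I : set {mpoly K[n]}) (G : set 'X_{1..n}) : Prop :=
  I = monomial_span G /\
  forall H : set 'X_{1..n}, H `<=` G -> I = monomial_span H -> H = G.

Definition pure_power_ideal (K : fieldType) (n m : nat)
    (j : 'I_m -> 'I_n) (c : 'I_m -> nat) : set {mpoly K[n]} :=
  ideal_span (range (fun l : 'I_m => 'X_(j l) ^+ c l)).

Definition variable_ideal (K : fieldType) (n m : nat) (j : 'I_m -> 'I_n) :
    set {mpoly K[n]} :=
  ideal_span (range (fun l : 'I_m => 'X_(j l))).

Definition is_pure_power_ideal (K : fieldType) (n : nat)
    (Q : set {mpoly K[n]}) : Prop :=
  exists (m : nat) (j : 'I_m -> 'I_n) (c : 'I_m -> nat),
    [/\ injective j, (forall l, (0 < c l)%N) & Q = pure_power_ideal j c].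

Definition is_irredundant_irreducible_decomposition (K : fieldType) (n : nat)
    (I : set {mpoly K[n]}) (r : nat) (Q : 'I_r -> set {mpoly K[n]}) : Prop :=
  [/\ (forall t, is_pure_power_ideal (Q t)),
      I = \bigcap_t Q t
    & (forall t, I <> \bigcap_(t' in [set~ t]) Q t')].

(* Main.v *)
Require Import Defs.

Set Implicit Arguments.
Unset Strict Implicit.
Unset Printing Implicit Defensive.

Import GRing.Theory.

Local Open Scope classical_set_scope.
Local Open Scope ring_scope.

(** Every ideal in sight is monomial, so membership of a polynomial means
    membership of each of its monomials ([monomial_spanX_supp]), and a monomial
    lies in such an ideal exactly when some generator divides it
    ([monomial_spanX]).  Everything thus reduces to comparing exponent vectors.

    Let [w] be the exponent vector of [v]; on the variables [x_(i l)] of [P] it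
    equals [a l - 1], so [v] only just fails to lie in the component [Q t].

    - If [m + w] lies in [I], hence in [Q t], then [a l <= m (i l) + a l - 1]
      for some [l], so [x_(i l)] divides [x^m].  Hence [(I : v)] is contained
      in [P].

    - Conversely, by irredundance some monomial [x^p] lies in every other
      component but not in [Q t] ([irredundant_separating_monomial]); the latter
      says that [p (i l) <= a l - 1] for all [l], that is, [p] is bounded by [w]
      on the variables of [P].  Then [x_(i l) x^(max(p, w))] lies in [Q t] as
      well as in the other components, hence in [I], so a minimal generator [g]
      of [I] divides it.  Outside [P] the exponents of [g] are bounded by the
      [b j], hence by [w], and inside [P] [max(p, w)] is [w]; so [g] divides
      [x_(i l) v], which therefore lies in [I]. *)

Lemma ideal_span_is_ideal (R : comNzRingType) (A : set R) :
  is_ideal (ideal_span A).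
Proof.
split=> [M|f g If Ig M|h f If M] HM; have [[M0 MD MM] _] := HM.
- exact: M0.
- apply: MD; [exact: If HM|exact: Ig HM].
- exact/MM/(If M HM).
Qed.

Section MonomialIdeals.
Variables (K : fieldType) (n : nat).
Implicit Types (A G : set 'X_{1..n}) (f : {mpoly K[n]}) (m g : 'X_{1..n}).

(** The right-hand side defines an ideal containing the generators, since a
    monomial of a sum or a product comes from the monomials of the operands; the
    span, being the smallest such ideal, is contained in it. *)
Lemma monomial_spanP A f :
  monomial_span A f <->
  forall m, m \in msupp f -> exists2 g, A g & (g <= m)%MM.
Proof.
have [S0 SD SM] := ideal_span_is_ideal [set 'X_[K, m] | m in A].
split.
  pose J := [set h : {mpoly K[n]} |
    forall m, m \in msupp h -> exists2 g, A g & (g <= m)%MM].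
  apply: (@smallest_sub _ _ _ J).
    split=> [m|h1 h2 J1 J2 m|h1 h2 J2 m]; first by rewrite msupp0.
      by move/msuppD_le; rewrite mem_cat => /orP[/J1|/J2].
    move/msuppM_le => /allpairsP[[m1 m2] /= [_ /J2[g Ag le_g] ->]].
    by exists g => //; apply: lepm_trans le_g _; apply: lem_addl.
  by move=> _ [g Ag <-] m /mem_msuppXP <-; exists g => //; apply: lepm_refl.
move=> Hf; rewrite [f]mpolyE big_seq; apply: big_ind => // m /Hf[g Ag le_g].
rewrite -(submK le_g) mpolyXD -mul_mpolyC mulrA; apply: SM.
by apply: sub_gen_smallest; exists g.
Qed.

Lemma monomial_spanX A m :
  monomial_span A 'X_[K, m] <-> exists2 g, A g & (g <= m)%MM.
Proof.
split=> [/monomial_spanP|AX]; first by apply; apply/mem_msuppXP.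
by apply/monomial_spanP => m' /mem_msuppXP <-.
Qed.

Lemma monomial_spanX_supp A f :
  monomial_span A f <-> forall m, m \in msupp f -> monomial_span A 'X_[K, m].
Proof.
split=> [/monomial_spanP Hf m /Hf|Hf]; first by move/monomial_spanX.
by apply/monomial_spanP => m /Hf /monomial_spanX.
Qed.

Lemma monomial_spanX_le A m1 m2 : (m1 <= m2)%MM ->
  monomial_span A 'X_[K, m1] -> monomial_span A 'X_[K, m2].
Proof.
move=> le12 /monomial_spanX[g Ag le_g]; apply/monomial_spanX.
by exists g => //; apply: lepm_trans le12.
Qed.

Lemma pure_power_idealE k (j : 'I_k -> 'I_n) (c : 'I_k -> nat) :
  pure_power_ideal j c =
  monomial_span (K := K) (range (fun l => U_(j l) *+ c l)%MM).
Proof.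
rewrite /pure_power_ideal /monomial_span image_comp; congr ideal_span.
by apply: eq_imagel => l _ /=; rewrite mpolyXn.
Qed.

Lemma pure_power_idealX k (j : 'I_k -> 'I_n) (c : 'I_k -> nat) m :
  pure_power_ideal j c 'X_[K, m] <-> exists l, (c l <= m (j l))%N.
Proof.
rewrite pure_power_idealE; split.
  move=> /monomial_spanX[_ [l _ <-]] /mnm_lepP /(_ (j l)).
  by rewrite mulmnE mnm1E eqxx mul1n; exists l.
move=> [l le_l]; apply/monomial_spanX; exists (U_(j l) *+ c l)%MM; first by exists l.
apply/mnm_lepP => x; rewrite mulmnE mnm1E.
by case: eqP => [<-|_]; rewrite ?mul1n.
Qed.

Lemma is_pure_power_idealE (J : set {mpoly K[n]}) :
  is_pure_power_ideal J -> exists A, J = monomial_span A.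
Proof. by move=> [k [j [c [_ _ ->]]]]; rewrite pure_power_idealE; eexists. Qed.

(** If omitting [Q t] changes the intersection, some polynomial lies in all the
    other components but not in [Q t]; as [Q t] is monomial, one of the monomials
    of that polynomial is already outside [Q t]. *)
Lemma irredundant_separating_monomial (I : set {mpoly K[n]}) r
    (Q : 'I_r -> set {mpoly K[n]}) (t : 'I_r) :
  is_irredundant_irreducible_decomposition I Q ->
  exists2 m, (forall t', t' <> t -> Q t' 'X_[m]) & ~ Q t 'X_[m].
Proof.
move=> [ppQ IE irrQ]; apply: contrapT => noX.
apply: (irrQ t); rewrite IE; apply/seteqP; split=> f Qf t' _; first exact: Qf.
have [->|/eqP neq_t] := eqVneq t' t; last exact: Qf.
have [A QA] := is_pure_power_idealE (ppQ t).
rewrite QA; apply/monomial_spanX_supp => m mf; rewrite -QA.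
apply: contrapT => nQ; apply: noX; exists m => // t2 neq_t2.
have [B QB] := is_pure_power_idealE (ppQ t2).
have := Qf t2 neq_t2; rewrite QB => /monomial_spanX_supp; exact.
Qed.

End MonomialIdeals.

Theorem theorem3p1 (K : fieldType) (n : nat) (I : set {mpoly K[n]})
    (hI : is_monomial_ideal I)
    (G : set 'X_{1..n}) (hG : is_minimal_monomial_generators I G)
    (r : nat) (Q : 'I_r -> set {mpoly K[n]})
    (hQ : is_irredundant_irreducible_decomposition I Q)
    (k : nat) (i : 'I_k -> 'I_n) (hi : injective i)
    (P : set {mpoly K[n]}) (hP : P = variable_ideal i) (hPI : Ass I P)
    (a : 'I_k -> nat) (ha : forall l, (0 < a l)%N)
    (t : 'I_r) (hQt : Q t = pure_power_ideal i a) (hrad : radical (Q t) = P)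
    (s : 'I_(n - k) -> 'I_n) (hs : range s = ~` range i)
    (b : 'I_(n - k) -> nat)
    (hb : forall j (u : 'X_{1..n}), G u -> (u (s j) <= b j)%N) :
  P = colon I ((\prod_(l < k) 'X_(i l) ^+ (a l - 1)%N) *
               (\prod_(j < n - k) 'X_(s j) ^+ b j)).
Proof.
pose w := (\sum_(l < k) U_(i l) *+ (a l - 1) + \sum_(j < n - k) U_(s j) *+ b j)%MM.
have -> : (\prod_(l < k) 'X_(i l) ^+ (a l - 1)%N) *
          (\prod_(j < n - k) 'X_(s j) ^+ b j) = 'X_[K, w].
  rewrite mpolyXD -!mprodXE.
  by congr (_ * _); apply: eq_bigr => l _; rewrite mpolyXn.
have wi l : w (i l) = (a l - 1)%N.
  rewrite mnmDE !mnm_sumE (bigD1 l) //= mulmnE mnm1E eqxx mul1n.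
  rewrite !big1 ?addn0 // => [j _|l' neq_l]; rewrite mulmnE mnm1E.
    have : range s (s j) by exists j.
    by rewrite hs; case: eqP => [-> []|//]; exists l.
  by rewrite (inj_eq hi) (negbTE neq_l).
have ws j : (b j <= w (s j))%N.
  rewrite mnmDE !mnm_sumE [X in (_ + X)%N](bigD1 j) //= mulmnE mnm1E eqxx mul1n.
  by rewrite addnCA leq_addr.
have [ppQ IE _] := hQ.
have [IG _] := hG.
(* ['X_j ^+ 1] is convertible to ['X_j]. *)
have PE : P = pure_power_ideal i (fun=> 1%N) by [].
apply/seteqP; split=> [f Pf|f].
  have [I0 ID IM] : is_ideal I by rewrite IG; apply: ideal_span_is_ideal.
  (* [(I : v)] is an ideal, so it suffices that it contains the generators. *)
  move: f Pf; rewrite hP; apply: smallest_sub.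
    split=> [|f g If Ig|h f If]; rewrite /colon /= ?mul0r //.
      by rewrite mulrDl; apply: ID.
    by rewrite -mulrA; apply: IM.
  move=> _ [l _ <-]; rewrite /colon /= -mpolyXD.
  have [p pQ npQ] := irredundant_separating_monomial t hQ.
  have pi l' : (p (i l') <= a l' - 1)%N.
    rewrite leqNgt; apply/negP => lt_p; apply: npQ.
    by rewrite hQt; apply/pure_power_idealX; exists l'; rewrite -(subnK (ha l')) addn1.
  (* Raising [p] to at least [w] keeps it inside the other components, and
     leaves exponent [a l' - 1] on [x_(i l')], one factor short of [Q t]. *)
  pose q := [multinom maxn (p x) (w x) | x < n].
  have Iq : I 'X_[(U_(i l) + q)%MM].
    rewrite IE => t' _; have [->|/eqP neq_t] := eqVneq t' t.
      rewrite hQt; apply/pure_power_idealX; exists l.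
      rewrite mnmDE mnm1E eqxx mnmE wi -{1}(subnKC (ha l)) leq_add2l.
      exact: leq_maxr.
    have := pQ t' neq_t; have [A ->] := is_pure_power_idealE (ppQ t').
    apply: monomial_spanX_le; apply: lepm_trans (lem_addl _ _).
    by apply/mnm_lepP => x; rewrite mnmE leq_maxl.
  move: Iq; rewrite IG => /monomial_spanX[g Gg /mnm_lepP le_g].
  apply/monomial_spanX; exists g => //; apply/mnm_lepP => x.
  have [[l' _ <-]|nix] := pselect (range i x).
    have := le_g (i l'); rewrite mnmDE [q _]mnmE wi (maxn_idPr (pi l')).
    by rewrite [(_ + w)%MM _]mnmDE wi.
  have [j _ <-] : range s x by rewrite hs.
  by rewrite mnmDE (leq_trans (hb j _ Gg)) // (leq_trans (ws j)) // leq_addl.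
rewrite /colon /= IE => /(_ t Logic.I) Qfv.
rewrite PE pure_power_idealE; apply/monomial_spanX_supp => m mf.
rewrite -pure_power_idealE; apply/pure_power_idealX.
have : Q t 'X_[(w + m)%MM].
  move: Qfv; rewrite hQt pure_power_idealE => /monomial_spanX_supp; apply.
  by rewrite (perm_mem (msuppMX _ _)) map_f.
rewrite hQt => /pure_power_idealX[l]; rewrite mnmDE wi => le_a; exists l.
by move: le_a; rewrite -{1}(subnK (ha l)) leq_add2l.
Qed.
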